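(* Let $I=\langle \mathcal{N},\mathcal{R},L,\pi^0\rangle$ be a single-peaked instance and let $\pi^{TTC}$ be the allocation returned by the Top Trading Cycle (TTC) algorithm on $I$. Then $\pi^{TTC}$ is reachable by swap-deals from $\pi^0$, i.e. there is a (possibly empty) sequence of improving swap-deals leading from $\pi^0$ to $\pi^{TTC}$.
   Context: Housing market: an instance is $I=\langle \mathcal{N},\mathcal{R},L,\pi^0\rangle$ with $\mathcal{N}$ a set of $n$ agents, $\mathcal{R}$ a set of $n$ resources, $L$ a profile of strict linear orders $\succ_i$ over $\mathcal{R}$, one for each agent $a_i$, and $\pi^0$ an initial allocation; an allocation $\pi$ is a bijective assignment of one resource $\pi_{a_i}$ to each agent $a_i$. The instance is single-peaked if there is a linear order $\lhd$ over $\mathcal{R}$ such that for every agent $a_i$ with top resource $t_i$ and all resources $r,r'$, if $r'\lhd r\lhd t_i$ or $t_i\lhd r\lhd r'$ then $r\succ_i r'$. A swap-deal between two distinct agents exchanges the resources they currently hold; it is improving if both agents strictly prefer the resource they receive to the one they give away. TTC algorithm: maintain a set $N$ of available agents and a set $R$ of available resources, initially $N=\mathcal{N}$, $R=\mathcal{R}$. While $N\neq\emptyset$: build the directed bipartite graph on $N\cup R$ with an edge from each agent $a\in N$ to her most preferred resource in $R$, and an edge from each resource $r\in R$ to its owner in $\pi^0$; select a cycle of this graph (one always exists; it may involve a single agent owning her top resource in $R$); allocate to each agent of the cycle the resource she points to; remove the agents and resources of the cycle from $N$ and $R$. The outcome $\pi^{TTC}$ does not depend on the choices of cycles. *)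

(* Defs.v *)
From mathcomp Require Import all_boot perm.

Set Implicit Arguments.
Unset Strict Implicit.
Unset Printing Implicit Defensive.

Definition strict_linear_order (T : eqType) (e : rel T) : Prop :=
  [/\ irreflexive e, transitive e & forall x y, x != y -> e x y || e y x].

(* [pref I a r s] reads "agent a strictly prefers r to s".  The bijection
   [endow] forces the (finite) numbers of agents and resources to be equal. *)
Record housing_market (N R : finType) := HousingMarket {
  pref : N -> rel R;
  pref_linear : forall a, strict_linear_order (pref a);
  endow : {ffun N -> R};
  endow_bij : bijective endow
}.

Section HousingMarket.
Variables (N R : finType) (I : housing_market N R).

Definition is_best (S : {set R}) (a : N) (r : R) : bool :=
  (r \in S) && [forall s in S, (s != r) ==> pref I a r s].

(* [lt r s] renders r <| s. *)
Definition single_peaked_wrt (lt : rel R) : Prop :=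
  forall (a : N) (t : R), is_best setT a t ->
  forall r r' : R, (lt r' r && lt r t) || (lt t r && lt r r') -> pref I a r r'.

Definition single_peaked : Prop :=
  exists lt : rel R, strict_linear_order lt /\ single_peaked_wrt lt.

Definition swap (pi : {ffun N -> R}) (a b : N) : {ffun N -> R} :=
  [ffun x => pi (tperm a b x)].

Definition improving_pair (pi : {ffun N -> R}) (a b : N) : bool :=
  [&& a != b, pref I a (pi b) (pi a) & pref I b (pi a) (pi b)].

Definition improving_swap : rel {ffun N -> R} :=
  fun pi pi' => [exists a, exists b, improving_pair pi a b && (pi' == swap pi a b)].

Definition reachable (pi pi' : {ffun N -> R}) : bool :=
  connect improving_swap pi pi'.

(* The graph on the available agents A and the available resources S. *)
Definition ttc_edge (A : {set N}) (S : {set R}) : rel (N + R) :=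
  fun u v => match u, v with
  | inl a, inr r => (a \in A) && is_best S a r
  | inr r, inl a => [&& r \in S, a \in A & endow I a == r]
  | _, _ => false
  end.

(* [ttc_run pi A S]: some execution of the loop, started with available agents
   A and available resources S, terminates and allocates [pi a] to every agent
   a of A.  The cycle c of each round is arbitrary. *)
Inductive ttc_run (pi : {ffun N -> R}) : {set N} -> {set R} -> Prop :=
| ttc_done S : ttc_run pi set0 S
| ttc_round A S (c : seq (N + R)) of
    c != [::] & ucycle (ttc_edge A S) c
    & (forall a, inl a \in c -> ttc_edge A S (inl a) (inr (pi a)))
    & ttc_run pi (A :\: [set a | inl a \in c]) (S :\: [set r | inr r \in c]) :
    ttc_run pi A S.

Definition ttc_outcome (pi : {ffun N -> R}) : Prop := ttc_run pi setT setT.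

(* The remainder checks that the algorithm always has an outcome. *)

Lemma is_best_exists (S : {set R}) (a : N) (r0 : R) :
  r0 \in S -> exists r, is_best S a r.
Proof.
move=> r0S; have [irr tr tot] := pref_linear I a.
case: (arg_maxnP (fun r => #|[set s | pref I a r s]|) r0S) => r rS rmax.
have {}rS : r \in S := rS.
exists r; rewrite /is_best rS /=; apply/forall_inP => s sS; apply/implyP => sr.
case/orP: (tot _ _ sr) => // psr.
suff /proper_card : [set x | pref I a r x] \proper [set x | pref I a s x].
  by rewrite ltnNge => /negP[]; apply: rmax.
apply/properP; split.
  by apply/subsetP => x; rewrite !inE; apply: tr.
by exists r; rewrite inE ?irr.
Qed.

Lemma ttc_cycle_exists (A : {set N}) : A != set0 ->
  exists2 c, c != [::] & ucycle (ttc_edge A (endow I @: A)) c.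
Proof.
case/set0Pn => a0 a0A; set S := endow I @: A; set e := ttc_edge A S.
pose f u := odflt u [pick v | e u v].
pose V u := match u with inl a => a \in A | inr r => r \in S end.
have eV u v : e u v -> V v.
  by case: u v => [a|r] [b|s] //= => [/andP[_ /andP[]]|/and3P[]].
have ef u : V u -> e u (f u).
  move=> Vu; rewrite /f; case: pickP => //= e0; exfalso.
  case: u Vu e0 => [a|r] /= Vu e0.
    have [r rb] := is_best_exists a (imset_f (endow I) a0A).
    by have := e0 (inr r); rewrite /e /= Vu rb.
  case/imsetP: (Vu) => a aA ra.
  by have := e0 (inl a); rewrite /e /= Vu aA ra eqxx.
have Vit n u : V u -> V (iter n f u).
  by move=> Vu; elim: n => //= n /ef; apply: eV.
have /trajectP[i lti eqi] := looping_order f (inl a0).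
set x := iter i f (inl a0) in eqi.
have Vx : V x by apply: Vit.
exists (orbit f x); first by rewrite -size_eq0 size_orbit -lt0n order_gt0.
rewrite /ucycle orbit_uniq andbT.
have /(orbitPcycle 3 0) fc : exists k, iter k.+1 f x = x.
  exists (order f (inl a0) - i.+1).
  by rewrite {1}/x -iterD addSnnS subnK.
apply: (sub_in_cycle (P := [pred u | V u])) fc; last first.
  by apply/allP => y; rewrite -fconnect_orbit => /iter_findex <-; apply: Vit.
by move=> u v Vu _ /= /eqP <-; apply: ef.
Qed.

Lemma ttc_run_ext (pi pi' : {ffun N -> R}) (A : {set N}) S :
  {in A, pi =1 pi'} -> ttc_run pi A S -> ttc_run pi' A S.
Proof.
move=> + run; elim: run => [*|{}A {}S c c0 uc cpi _ IH eqpi]; first exact: ttc_done.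
apply: (ttc_round c0 uc).
  by move=> a /cpi /[dup] /andP[aA _]; rewrite eqpi.
by apply: IH => a /setDP[aA _]; apply: eqpi.
Qed.

Lemma ttc_outcome_exists : exists pi, ttc_outcome pi.
Proof.
have [g gK Kg] := endow_bij I.
suff run A : exists pi, ttc_run pi A (endow I @: A).
  have [pi] := run setT; suff -> : endow I @: setT = setT by exists pi.
  by apply/setP => r; rewrite !inE -[r]Kg imset_f ?inE.
have [n] := ubnP #|A|; elim: n A => // n IH A leAn.
have [->|A0] := eqVneq A set0; first by exists (endow I); apply: ttc_done.
have [c c0 /[dup] uc /andP[cc _]] := ttc_cycle_exists A0.
have memc a : (inl a \in c) = (inr (endow I a) \in c).
  apply/idP/idP => [ac|rc].
    have := prev_cycle cc ac; have := mem_prev c (inl a); rewrite ac.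
    by case: (prev c _) => [//|r] rc /and3P[_ _ /eqP->].
  have := next_cycle cc rc; have := mem_next c (inr (endow I a)); rewrite rc.
  by case: (next c _) => [b bc|//] /and3P[_ _ /eqP/(can_inj gK) <-].
have agent_next a : inl a \in c ->
    exists r, ttc_edge A (endow I @: A) (inl a) (inr r).
  by move=> /(next_cycle cc); case: (next c _) => // r; exists r.
set B := A :\: [set a | inl a \in c].
have eqS : endow I @: A :\: [set r | inr r \in c] = endow I @: B.
  rewrite /B; apply/setP => r; rewrite -[r]Kg.
  by rewrite !inE !(mem_imset _ _ (can_inj gK)) !inE memc.
have [a ac] : exists a, inl a \in c.
  case: c c0 memc {uc cc agent_next B eqS} => // -[a|r] c _ memc.
    by exists a; rewrite mem_head.
  by exists (g r); rewrite memc Kg mem_head.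
have [] := IH B.
  rewrite -ltnS (leq_trans _ leAn) // ltnS proper_card //; apply/properP; split.
    exact: subsetDl.
  by exists a; [case: (agent_next a ac) => r /andP[] | rewrite !inE ac].
move=> pi run; pose edge x r := ttc_edge A (endow I @: A) (inl x) (inr r).
pose pi' := [ffun x => if inl x \in c then odflt (pi x) [pick r | edge x r] else pi x].
exists pi'; apply: (ttc_round c0 uc) => [x xc|].
  rewrite ffunE xc; case: pickP => // no; have [r] := agent_next x xc.
  by rewrite -/(edge x r) no.
rewrite eqS; apply: ttc_run_ext run => x.
by rewrite !inE ffunE => /andP[/negPf->].
Qed.

End HousingMarket.

(* Main.v *)
(** Identify each agent of a trading cycle with the resource she gets, which is
    her peak among the available resources.  Along the single-peaked axis the
    cycle is then a permutation to be sorted.  Take the agent [j] that has to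
    move right from the rightmost position [q], and the first position [p > q]
    held by an agent [i] that has to move left: everything strictly between [q]
    and [p] is already in place, so the destination of [i] is at most [q] and
    that of [j] is at least [p].  Hence exchanging [q] and [p] brings both agents
    closer to their peaks without overshooting, and single-peakedness makes the
    swap improving.  Improving swaps cannot go on forever, so the cycle gets
    implemented, and the cycles are treated one after the other. *)

Require Import Defs.
From mathcomp Require Import all_boot perm.
From mathcomp Require Import zify.

Set Implicit Arguments.
Unset Strict Implicit.
Unset Printing Implicit Defensive.

(** Counting predecessors embeds the order in the naturals, so that comparisons along the axis
    become arithmetic. *)
Lemma strict_linear_order_rank (T : finType) (lt : rel T) :
    strict_linear_order lt ->
  exists2 rk : T -> nat, injective rk & forall x y, lt x y = (rk x < rk y).
Proof.
case=> irr tr tot; pose rk x := #|[set z | lt z x]|.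
have rk_lt x y : lt x y -> rk x < rk y.
  move=> xy; apply/proper_card/properP; split.
    by apply/subsetP => z; rewrite !inE => /tr; apply.
  by exists x; rewrite inE ?irr.
exists rk => [x y eq_rk|x y].
  by apply/eqP/contraT => /tot/orP[] /rk_lt; rewrite eq_rk ltnn.
apply/idP/idP => [/rk_lt //|].
have [->|/tot/orP[//|/rk_lt yx xy]] := eqVneq x y; first by rewrite ltnn.
by have := ltn_trans xy yx; rewrite ltnn.
Qed.

Lemma imset_inj_stable (T T' : finType) (f : T -> T') (s : {perm T}) (B : {set T}) :
  {in B, forall x, s x \in B} -> [set f (s x) | x in B] = f @: B.
Proof.
move=> sB; have sBB : s @: B = B.
  apply/eqP; rewrite eqEcard card_imset; last exact: perm_inj.
  by rewrite leqnn andbT; apply/subsetP => _ /imsetP[x xB ->]; apply: sB.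
by rewrite -[in RHS]sBB -imset_comp.
Qed.

(* [rk (p x)] is the position of token [x] and [rk (t x)] its destination. *)
Lemma exchangeable_pair (N R : finType) (rk : R -> nat) (p t : N -> R) (B : {set N}) :
    injective rk -> injective p -> {in B &, injective t} -> p @: B = t @: B ->
    (exists2 b, b \in B & p b != t b) ->
  exists i j, [/\ i \in B, j \in B &
    [&& rk (t i) <= rk (p j), rk (p j) < rk (p i) & rk (p i) <= rk (t j)]].
Proof.
move=> rk_inj p_inj t_inj ptB [b0 b0B b0m].
(* If the holder [y] of [t x] were settled, then [t y = t x], and injectivity of [t] on [B] would
   give [y = x]. *)
have holder x : x \in B -> p x != t x ->
    exists y, [/\ y \in B, p y != t y & p y = t x].
  move=> xB xm; have : t x \in p @: B by rewrite ptB imset_f.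
  case/imsetP => y yB eqy; exists y; split=> //; rewrite -eqy.
  by apply: contraNneq xm => /(t_inj _ _ xB yB) eqxy; rewrite [in p x]eqxy eqy.
have mover x : (p x != t x) = (rk (p x) != rk (t x)) by rewrite (inj_eq rk_inj).
(* The leftmost unsettled token moves right, since its destination is held by another unsettled
   token. *)
have [j0 j0B j0m] : exists2 j, j \in B & rk (p j) < rk (t j).
  have m0 : (b0 \in B) && (p b0 != t b0) by rewrite b0B.
  case: (arg_minnP (P := fun x => (x \in B) && (p x != t x)) (fun x => rk (p x)) m0).
  move=> j /andP[jB jm] jmin; exists j => //.
  have [y [yB ym eqy]] := holder j jB jm.
  have := jmin y; rewrite yB ym eqy => /(_ isT).
  by move: jm; rewrite mover ltn_neqAle => -> ->.
have m1 : (j0 \in B) && (rk (p j0) < rk (t j0)) by rewrite j0B.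
case: (arg_maxnP (P := fun x => (x \in B) && (rk (p x) < rk (t x)))
        (fun x => rk (p x)) m1).
move=> j /andP[jB jm] jmax.
have jm' : p j != t j by rewrite mover ltn_eqF.
have [y [yB ym eqy]] := holder j jB jm'.
(* The unsettled token at the destination of [j] cannot move right, as [j] is the rightmost token
   that does; hence a candidate for [i] exists. *)
have y_left : [&& y \in B, rk (t y) < rk (p y) & rk (p j) < rk (p y)].
  rewrite yB eqy jm andbT /= ltnNge leq_eqVlt negb_or.
  apply/andP; split; first by rewrite -eqy -mover.
  apply/negP => yr; have := jmax y; rewrite yB eqy yr => /(_ isT).
  by rewrite /= leqNgt jm.
case: (arg_minnP (P := fun x => [&& x \in B, rk (t x) < rk (p x) & rk (p j) < rk (p x)])
        (fun x => rk (p x)) y_left).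
move=> i /and3P[iB il ji] imin.
have settled z : z \in B -> rk (p j) < rk (p z) < rk (p i) -> p z = t z.
  move=> zB /andP[jz zi]; apply: contraTeq isT => zm.
  case: (ltngtP (rk (p z)) (rk (t z))) => [zr|zl|/rk_inj eqz].
  - by have := jmax z; rewrite zB zr => /(_ isT) /=; lia.
  - by have := imin z; rewrite zB zl jz => /(_ isT) /=; lia.
  - by rewrite eqz eqxx in zm.
have outside x : x \in B -> p x != t x -> ~~ (rk (p j) < rk (t x) < rk (p i)).
  move=> xB xm; have [z [zB zm eqz]] := holder x xB xm.
  by apply/negP; rewrite -eqz => /(settled z zB) eqpt; rewrite eqpt eqxx in zm.
exists i, j; split=> //.
have im : p i != t i by rewrite mover; lia.
by have := outside i iB im; have := outside j jB jm'; lia.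
Qed.

Section Market.
Variables (N R : finType) (I : housing_market N R).
Implicit Types (p t : {ffun N -> R}) (B A : {set N}) (S : {set R}).

Lemma is_bestP S a r s : is_best I S a r -> s \in S -> s != r -> pref I a r s.
Proof. by case/andP=> _ /forall_inP H sS; apply/implyP/H. Qed.

Lemma is_best_uniq S a r s : is_best I S a r -> is_best I S a s -> r = s.
Proof.
move=> br bs; have [irr tr _] := pref_linear I a.
have [rS sS] : r \in S /\ s \in S by case/andP: br; case/andP: bs.
apply: contraTeq isT => rs.
have := tr _ _ _ (is_bestP br sS _) (is_bestP bs rS rs).
by rewrite irr eq_sym rs => /(_ isT).
Qed.

(* If the global top lies between [r] and the top of [S], then [r] would be
   preferred to the latter. *)
Lemma single_peaked_subset (lt : rel R) S a m r r' :
    strict_linear_order lt -> single_peaked_wrt I lt -> is_best I S a m ->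
    r \in S -> (lt r' r && lt r m) || (lt m r && lt r r') ->
  pref I a r r'.
Proof.
move=> [irr tr tot] sp bm rS between.
have [irrp trp _] := pref_linear I a.
have [t bt] := is_best_exists I a (in_setT r).
have ltF x y : lt x y -> lt y x -> false.
  by move=> xy yx; rewrite -(irr x) (tr _ _ _ xy yx).
have nrm : r != m.
  by apply/eqP => rm; move: between; rewrite rm irr andbF.
have rm_false : pref I a r m -> false.
  by move=> prm; rewrite -(irrp r) (trp _ _ _ prm (is_bestP bm rS nrm)).
have [rt|nrt] := eqVneq r t.
  rewrite rt; apply: is_bestP bt _ _; rewrite ?inE // -rt.
  by apply/eqP => eqr; move: between; rewrite eqr irr andbF.
case/orP: between => /andP[l1 l2]; case/orP: (tot _ _ nrt) => l3.
- by apply: sp bt _ _ _; rewrite l1 l3.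
- by have := rm_false (sp _ _ bt r m _); rewrite l3 l2 orbT => /(_ isT).
- by have := rm_false (sp _ _ bt r m _); rewrite l1 l3 => /(_ isT).
- by apply: sp bt _ _ _; rewrite l3 l2 orbT.
Qed.

Lemma improving_pair_exists p t B S :
    single_peaked I -> injective p -> p @: B = t @: B ->
    {in B, forall b, is_best I S b (t b)} ->
    (exists2 b, b \in B & p b != t b) ->
  exists i j, [/\ i \in B, j \in B & improving_pair I p i j].
Proof.
move=> [lt [ltlin sp]] p_inj ptB bestB unsettled.
have t_inj : {in B &, injective t}.
  by apply/imset_injP; rewrite -ptB card_imset.
have [rk rk_inj ltE] := strict_linear_order_rank ltlin.
have [i [j [iB jB]]] := exchangeable_pair rk_inj p_inj t_inj ptB unsettled.
move=> /and3P[tipj pjpi pitj]; exists i, j; split=> //.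
have pS b : b \in B -> p b \in S.
  move=> bB; have : p b \in t @: B by rewrite -ptB imset_f.
  by case/imsetP => c cB ->; case/andP: (bestB c cB).
have closer b r r' : b \in B -> r \in S -> r' \in S ->
    (rk (t b) <= rk r < rk r') || (rk r' < rk r <= rk (t b)) -> pref I b r r'.
  (* Single-peakedness only compares resources strictly on one side of the peak; at the peak itself,
     [t b] being best in [S] concludes. *)
  move=> bB rS r'S btw; have [eqr|nr] := eqVneq r (t b).
    rewrite eqr in btw *; apply: is_bestP (bestB b bB) r'S _.
    by rewrite -(inj_eq rk_inj); lia.
  apply: single_peaked_subset ltlin sp (bestB b bB) rS _; rewrite !ltE.
  by move: nr; rewrite -(inj_eq rk_inj); lia.
apply/and3P; split; first by apply/eqP => eqij; rewrite eqij ltnn in pjpi.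
  by apply: closer; rewrite ?pS ?tipj ?pjpi.
by apply: closer; rewrite ?pS ?pjpi ?pitj ?orbT.
Qed.

(** Termination measure: by transitivity an improving swap creates no new envy, and it removes the
    envy of each swapper for what she receives. *)
Definition envy p : {set N * R} := [set x | pref I x.1 x.2 (p x.1)].

Lemma envy_swap p a b :
  improving_pair I p a b -> #|envy (swap p a b)| < #|envy p|.
Proof.
move=> /and3P[_ pab pba]; apply/proper_card/properP; split.
  apply/subsetP => -[x r]; rewrite !inE /= ffunE.
  have [_ tr _] := pref_linear I x.
  by case: tpermP => // eqx; move: tr; rewrite ?eqx => tr /tr; apply.
exists (a, p b); rewrite !inE //= ffunE tpermL.
by have [-> _ _] := pref_linear I a.
Qed.

Lemma reachable_settle p t B S :
    single_peaked I -> injective p -> p @: B = t @: B ->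
    {in B, forall b, is_best I S b (t b)} ->
  reachable I p [ffun a => if a \in B then t a else p a].
Proof.
move=> sp + + bestB; have [n] := ubnP #|envy p|.
elim: n p => // n IH p; rewrite ltnS => le_n p_inj ptB.
have [settled|] := boolP [forall b in B, p b == t b].
  suff -> : [ffun a => if a \in B then t a else p a] = p by apply: connect0.
  apply/ffunP => a; rewrite ffunE; case: ifP => // aB.
  by move/forall_inP: settled => /(_ a aB)/eqP.
rewrite negb_forall => /existsP[b]; rewrite negb_imply => /andP[bB bm].
have [|i [j [iB jB ij]]] := improving_pair_exists sp p_inj ptB bestB.
  by exists b.
have swapB : {in B, forall x, tperm i j x \in B}.
  by move=> x xB; case: tpermP.
(* The swap happens inside [B], so the target allocation is the same from [p] and from the swapped
   allocation. *)
have eq_goal : [ffun a => if a \in B then t a else p a] =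
    [ffun a => if a \in B then t a else swap p i j a].
  apply/ffunP => a; rewrite !ffunE; case: ifPn => // aB.
  by rewrite tpermD //; apply: contraNneq aB => <-.
rewrite eq_goal; apply: (connect_trans (y := swap p i j)).
  by apply/connect1/existsP; exists i; apply/existsP; exists j; rewrite ij eqxx.
apply: IH; first exact: leq_trans (envy_swap ij) le_n.
  by move=> x y; rewrite !ffunE => /p_inj/perm_inj.
rewrite -ptB -(imset_inj_stable p swapB).
by apply: eq_imset => x; rewrite ffunE.
Qed.

(** On the cycle, [a] is followed by [t a], then by the owner of [t a]; this gives one inclusion.
    Predecessors on a duplicate-free cycle are unique, so [t] is injective there and counting gives
    equality. *)
Lemma ttc_cycle_resources A S (c : seq (N + R)) t :
    ucycle (ttc_edge I A S) c ->
    (forall a, inl a \in c -> ttc_edge I A S (inl a) (inr (t a))) ->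
  endow I @: [set a | inl a \in c] = t @: [set a | inl a \in c].
Proof.
move=> /andP[cc uc] ct; set C := [set a | _].
have nextC a : inl a \in c -> next c (inl a) = inr (t a).
  move=> ac; have := next_cycle cc ac; case: (next c _) => [//|r] /andP[_ br].
  by case/andP: (ct a ac) => _ /(is_best_uniq br) ->.
have t_inj : {in C &, injective t}.
  move=> a b; rewrite !inE => ac bc tab.
  by apply/inl_inj/(can_inj (prev_next uc)); rewrite !nextC // tab.
apply/esym/eqP; rewrite eqEcard (card_in_imset t_inj) leq_imset_card andbT.
apply/subsetP => _ /imsetP[a + ->]; rewrite inE => ac.
have tc : inr (t a) \in c by rewrite -nextC // mem_next.
have := next_cycle cc tc; have := mem_next c (inr (t a)); rewrite tc.
by case: (next c _) => [b bc|//] /and3P[_ _ /eqP <-]; rewrite imset_f ?inE.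
Qed.

(** The induction needs a general [p]: agents outside [A] may already have traded, while those of
    [A] still hold their endowments. *)
Lemma ttc_run_reachable t A S p :
    single_peaked I -> ttc_run I t A S -> injective p ->
    {in A, p =1 endow I} ->
  reachable I p [ffun a => if a \in A then t a else p a].
Proof.
move=> sp run; elim: run p => [{}S|{}A {}S c c0 uc ct _ IH] p p_inj pA.
  suff -> : [ffun a => if a \in set0 then t a else p a] = p by apply: connect0.
  by apply/ffunP => a; rewrite ffunE inE.
set C := [set a | inl a \in c] in IH *.
have CA : {subset C <= A} by move=> a; rewrite inE => /ct/andP[].
have pC : p @: C = t @: C.
  by rewrite -(ttc_cycle_resources uc ct); apply: eq_in_imset => a /CA/pA.
have bestC : {in C, forall a, is_best I S a (t a)}.
  by move=> a; rewrite inE => /ct/andP[].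
have t_inj : {in C &, injective t}.
  by apply/imset_injP; rewrite -pC card_imset.
have step := reachable_settle sp p_inj pC bestC.
set q := [ffun a => _] in step; apply: connect_trans step _.
(* In [p], the resource [t a] is held by a member of [C]; this keeps [q] injective. *)
have apart a b : a \in C -> b \notin C -> t a != p b.
  move=> aC bC; have : t a \in p @: C by rewrite pC imset_f.
  by case/imsetP => d dC ->; apply: contraNneq bC => /p_inj <-.
have q_inj : injective q.
  move=> a b; rewrite !ffunE; case: ifPn => aC; case: ifPn => bC.
  - exact: t_inj.
  - by move/eqP; rewrite (negPf (apart _ _ aC bC)).
  - by move/esym/eqP; rewrite (negPf (apart _ _ bC aC)).
  - exact: p_inj.
have qA : {in A :\: C, q =1 endow I}.
  by move=> a /setDP[aA /negPf aC]; rewrite ffunE aC pA.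
suff -> : [ffun a => if a \in A then t a else p a] =
    [ffun a => if a \in A :\: C then t a else q a] by apply: IH.
apply/ffunP => a; rewrite !ffunE in_setD.
by case: (boolP (a \in C)) => // /CA ->.
Qed.

End Market.

Theorem proposition5 (N R : finType) (I : housing_market N R)
    (piTTC : {ffun N -> R}) :
  single_peaked I -> ttc_outcome I piTTC -> reachable I (endow I) piTTC.
Proof.
move=> sp run.
have := ttc_run_reachable sp run (bij_inj (endow_bij I)) (fun _ _ => erefl).
suff -> : [ffun a => if a \in setT then piTTC a else endow I a] = piTTC by [].
by apply/ffunP => a; rewrite ffunE inE.
Qed.
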